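(* Suppose that $X\subseteq\mathbb{R}^n$ is compact, that $f:\mathbb{R}^n\to\mathbb{R}$ is continuous, and that the following hold: (i) for each $x\in X$ the random variable $C(x,\xi)$ has a continuous distribution; (ii) $C$ is a Carathéodory function, i.e., $C(x,\cdot)$ is measurable for every $x\in X$ and $C(\cdot,\xi)$ is continuous for a.e. $\xi\in\Xi$; (iii) there exists a globally optimal solution $\bar x$ of the true problem $\min_{x\in X} f(x)$ s.t. $F(0;x)\ge 1-\alpha$ such that for any $\delta>0$ there is $x\in X$ with $\|x-\bar x\|\le\delta$ and $F(0;x)>1-\alpha$. Then, with probability 1, $v_\epsilon^N\to v^*$ and $\mathbb{D}(S_\epsilon^N,S)\to 0$ as $N\to\infty$ and $\epsilon\to 0$ ($\epsilon>0$).
   Context: Let $c:\mathbb{R}^n\times\mathbb{R}^s\to\mathbb{R}^m$, let $\xi$ be a random vector with support $\Xi\subseteq\mathbb{R}^s$, $\alpha\in(0,1)$, $C(x,\xi)=\max_{j=1,\dots,m}c_j(x,\xi)$, and $F(t;x)=\mathbb{P}(C(x,\xi)\le t)$. The true chance-constrained problem is $$\min_{x\in X} f(x)\quad\text{s.t. } F(0;x)=\mathbb{P}(c_j(x,\xi)\le 0,\ j=1,\dots,m)\ge 1-\alpha,$$ with optimal value $v^*$ and set of (globally) optimal solutions $S$. For each $\epsilon>0$ let $\Gamma_\epsilon:\mathbb{R}\to[0,1]$ be given by $\Gamma_\epsilon(y)=1$ for $y\le-\epsilon$, $\Gamma_\epsilon(y)=\gamma_\epsilon(y)$ for $-\epsilon<y<\epsilon$,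 $\Gamma_\epsilon(y)=0$ for $y\ge\epsilon$, where $\gamma_\epsilon:[-\epsilon,\epsilon]\to[0,1]$ is strictly decreasing, symmetric (in the sense that $1-\gamma_\epsilon(y)=\gamma_\epsilon(-y)$), and such that $\Gamma_\epsilon$ is differentiable. Let $\xi_1,\xi_2,\dots$ be i.i.d. copies of $\xi$, and for a sample of size $N$ set $C^N(x)=(C(x,\xi_1),\dots,C(x,\xi_N))\in\mathbb{R}^N$ and $F_\epsilon^N(t;x)=\frac1N\sum_{i=1}^N\Gamma_\epsilon(C(x,\xi_i)-t)$. For $N$ with $(1-\alpha)N\notin\mathbb{Z}$ and $z\in\mathbb{R}^N$, $Q_\epsilon(z)$ denotes the unique real $Q$ with $\sum_{i=1}^N\Gamma_\epsilon(z_i-Q)=(1-\alpha)N$. The approximate problem is $$\min_{x\in X} f(x)\quad\text{s.t. } Q_\epsilon(C^N(x))\le 0,$$ whose constraint is equivalent to $F_\epsilon^N(0;x)\ge 1-\alpha$; $v_\epsilon^N$ denotes its optimal value ($+\infty$ if infeasible) and $S_\epsilon^N$ its set of (globally) optimal solutions. Here $N$ ranges over positive integers with $(1-\alpha)N\notin\mathbb{Z}$. $\mathbb{D}(A,B)=\sup_{a\in A}\inf_{b\in B}\|a-b\|$ is the deviation of the set $A$ from the set $B$. The limit is the joint limit $N\to\infty$, $\epsilon\downarrow 0$ (i.e., along all sequences $N_k\to\infty$, $\epsilon_k\downarrow0$). *)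

(* Defs.v *)
From HB Require Import structures.
From mathcomp Require Import all_boot all_order all_algebra.
From mathcomp Require Import finmap.
From mathcomp Require Import all_classical all_reals all_analysis.

Set Implicit Arguments.
Unset Strict Implicit.
Unset Printing Implicit Defensive.

Import Order.TTheory GRing.Theory Num.Theory.
Import numFieldNormedType.Exports.

Local Open Scope classical_set_scope.
Local Open Scope ring_scope.

(* R^s with its Borel sigma-algebra; convertible to 'rV[R]_s. *)
Definition borel_rV (R : realType) (s : nat) :=
  g_sigma_algebraType (@open 'rV[R]_s).

(* The library norm `|v| on 'rV[R]_n is the sup norm, hence this definition. *)
Definition l2norm (R : realType) (n : nat) (v : 'rV[R]_n) : R :=
  Num.sqrt (\sum_(i < n) v ord0 i ^+ 2).

(* Values lie in \bar R, where the supremum of the empty set is -oo; so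
   deviation A B --> 0 forces A to be eventually nonempty. *)
Definition deviation (R : realType) (n : nat) (A B : set 'rV[R]_n) : \bar R :=
  ereal_sup [set ereal_inf [set (l2norm (a - b))%:E | b in B] | a in A].

Definition optimal_value (R : realType) (n : nat)
    (f : 'rV[R]_n -> R) (A : set 'rV[R]_n) : \bar R :=
  ereal_inf [set (f x)%:E | x in A].

Definition optimal_solutions (R : realType) (n : nat)
    (f : 'rV[R]_n -> R) (A : set 'rV[R]_n) : set 'rV[R]_n :=
  [set x | A x /\ forall y, A y -> f x <= f y].

Definition is_support (R : realType) (s : nat)
    (mu : set (borel_rV R s) -> \bar R) (Xi : set 'rV[R]_s) : Prop :=
  [/\ closed Xi, mu Xi = 1%E &
      forall K : set 'rV[R]_s, closed K -> mu K = 1%E -> Xi `<=` K].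

Definition mutually_independent d (Omega : measurableType d) d'
    (T : measurableType d') (R : realType) (P : probability Omega R)
    (X : nat -> {RV P >-> T}) : Prop :=
  forall (J : {fset nat}) (A : nat -> set T), (forall i, measurable (A i)) ->
    P (\bigcap_(i in [set` J]) (X i @^-1` A i)) =
    (\prod_(i <- J) P (X i @^-1` A i))%E.

Definition iid_copies d (Omega : measurableType d) d'
    (T : measurableType d') (R : realType) (P : probability Omega R)
    (Y : {RV P >-> T}) (X : nat -> {RV P >-> T}) : Prop :=
  mutually_independent X /\
  forall i (A : set T), measurable A ->
    distribution P (X i) A = distribution P Y A.

Section ChanceConstraint.
Context {R : realType} {n s m : nat}.
Variable c : 'rV[R]_n -> 'rV[R]_s -> 'rV[R]_m.+1.

Definition Cmax (x : 'rV[R]_n) (u : 'rV[R]_s) : R :=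
  \big[Num.max/c x u ord0 ord0]_(j < m.+1) c x u ord0 j.

Definition Fcdf d (Omega : measurableType d) (P : probability Omega R)
    (xi : Omega -> 'rV[R]_s) (t : R) (x : 'rV[R]_n) : R :=
  fine (P [set w | Cmax x (xi w) <= t]).

Definition true_feasible d (Omega : measurableType d) (P : probability Omega R)
    (xi : Omega -> 'rV[R]_s) (alpha : R) (X : set 'rV[R]_n) : set 'rV[R]_n :=
  [set x | X x /\ 1 - alpha <= Fcdf P xi 0 x].

Definition Csample (N : nat) (u : nat -> 'rV[R]_s) (x : 'rV[R]_n) : 'rV[R]_N :=
  \row_(i < N) Cmax x (u i).

End ChanceConstraint.

Definition Gamma (R : realType) (gamma : R -> R -> R) (eps y : R) : R :=
  if y <= - eps then 1 else if y < eps then gamma eps y else 0.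

Definition smoothing (R : realType) (gamma : R -> R -> R) (eps : R) : Prop :=
  [/\ forall y, - eps <= y <= eps -> 0 <= gamma eps y <= 1,
      forall y z, - eps <= y -> y < z -> z <= eps -> gamma eps z < gamma eps y,
      forall y, - eps <= y <= eps -> 1 - gamma eps y = gamma eps (- y) &
      forall y, derivable (Gamma gamma eps) y 1].

(* The default value 0 is never used when eps > 0 and (1 - alpha) * N is not an
   integer: the equation then has exactly one solution. *)
Definition Qeps (R : realType) (gamma : R -> R -> R) (alpha eps : R) (N : nat)
    (z : 'rV[R]_N) : R :=
  xget 0 [set Q | \sum_(i < N) Gamma gamma eps (z ord0 i - Q) =
                  (1 - alpha) * N%:R].

Definition approx_feasible (R : realType) (n s m : nat)
    (c : 'rV[R]_n -> 'rV[R]_s -> 'rV[R]_m.+1) (gamma : R -> R -> R)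
    (alpha : R) (X : set 'rV[R]_n) (u : nat -> 'rV[R]_s) (N : nat) (eps : R)
    : set 'rV[R]_n :=
  [set x | X x /\ Qeps gamma alpha eps (Csample c N u x) <= 0].

(* N --> oo and eps --> 0+ jointly, along the N with (1 - alpha) * N not an
   integer (so that in particular N > 0). *)
Definition joint_limit (R : realType) (alpha : R) : set_system (nat * R) :=
  within [set p | (1 - alpha) * p.1%:R \notin Num.int]
         (filter_prod \oo (0 : R)^'+).

(* Main.v *)
Require Import Defs.
From HB Require Import structures.
From mathcomp Require Import all_boot all_order all_algebra.
From mathcomp Require Import finmap.
From mathcomp Require Import all_classical all_reals all_analysis.
From mathcomp Require Import measurable_realfun lra.

Set Implicit Arguments.
Unset Strict Implicit.
Unset Printing Implicit Defensive.

Import Order.TTheory GRing.Theory Num.Theory.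
Import numFieldNormedType.Exports.

Local Open Scope classical_set_scope.
Local Open Scope ring_scope.

(* Fix a countable dense subset Z of X.  The law of large numbers (a Chernoff
   bound and Borel-Cantelli) is only needed for countably many events: for each
   centre z in Z and radius r = 1/(k+1), the event that C(z', xi) < r for some
   z' in Z within r of z; and, for a sequence x_k -> xbar of strictly feasible
   points, the event C(x_k, xi) > t_k with t_k < 0 still satisfying
   F(t_k; x_k) > 1 - alpha.  Continuity of C(., xi) makes the probabilities of
   the former events decrease to at most F(0; x) as the ball shrinks to x, so
   an infeasible x has a neighbourhood which almost surely contains no
   approximately feasible point for large N and small eps, while each x_k is
   almost surely eventually feasible.  Compactness of X turns these two local
   facts into convergence of the optimal values and of the solution sets. *)

(** * One-sided law of large numbers for the frequency of a single event *)

Section Frequencies.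
Context d (Omega : measurableType d) d' (T : measurableType d') (R : realType).
Variable P : probability Omega R.
Variables (Y : {RV P >-> T}) (X : nat -> {RV P >-> T}).
Hypothesis iidX : iid_copies Y X.
Variable A : set T.
Hypothesis mA : measurable A.

Let p := fine (P (Y @^-1` A)).

Let hit i : set Omega := X i @^-1` A.

Let hits (K : {fset nat}) : set Omega := \bigcap_(i in [set` K]) hit i.

(* Replaces exp(t S_N), S_N being the number of hits, in the Chernoff bound:
   its expectation (1 + u p)^N only involves probabilities of intersections. *)
Let weight (u : R) N (w : Omega) : R := \prod_(i < N) (1 + u * \1_(hit i) w).

Local Lemma measurable_hit i : measurable (hit i).
Proof. by rewrite /hit -[X in measurable X]setTI; exact: measurable_funP. Qed.

Local Lemma measurable_hits K : measurable (hits K).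
Proof.
apply: fin_bigcap_measurable => [|i _]; first exact: finite_fset.
exact: measurable_hit.
Qed.

Local Lemma prob_hit i : P (hit i) = p%:E.
Proof.
have := iidX.2 i A mA; rewrite /distribution /pushforward => ->.
rewrite fineK// fin_num_measure// -[X in measurable X]setTI.
exact: measurable_funP.
Qed.

Local Lemma prob_hits K : P (hits K) = (p ^+ #|` K|)%:E.
Proof.
rewrite (iidX.1 K (fun=> A))//.
rewrite (eq_bigr (fun=> p%:E)); last by move=> i _; exact: prob_hit.
by rewrite big_const_seq count_predT; elim: size => //= k ->; rewrite exprS EFinM.
Qed.

Local Lemma weight_ge0 (u : R) N w : 0 <= u -> 0 <= weight u N w.
Proof. by move=> u0; apply: prodr_ge0 => i _; rewrite addr_ge0// mulr_ge0. Qed.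

Local Lemma measurable_weight u N : measurable_fun [set: Omega] (weight u N).
Proof.
apply: measurable_prod => i _; apply: measurable_funD => //.
by apply: measurable_funM => //; exact/measurable_indicP/measurable_hit.
Qed.

(* The intersection of later hits is carried along for the induction on N, where
   the last factor of the weight adds N to K. *)
Local Lemma integral_weight_hits (u : R) N (K : {fset nat}) : 0 <= u ->
  (forall i, i \in K -> (N <= i)%N) ->
  (\int[P]_w (weight u N w * \1_(hits K) w)%:E =
   ((1 + u * p) ^+ N * p ^+ #|` K|)%:E)%E.
Proof.
move=> u0; elim: N K => [|N IH] K NK.
  under eq_integral do rewrite /weight big_ord0 mul1r.
  rewrite expr0 mul1r integral_indic//; last exact: measurable_hits.
  by rewrite setIT; exact: prob_hits.
have NnK : N \notin K by apply/negP => /NK; rewrite ltnn.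
have mW K' : measurable_fun [set: Omega]
    (fun w => (weight u N w * \1_(hits K') w)%:E).
  apply/measurable_EFinP; apply: measurable_funM; first exact: measurable_weight.
  exact/measurable_indicP/measurable_hits.
have W0 K' w : (0 <= (weight u N w * \1_(hits K') w)%:E)%E.
  by rewrite lee_fin mulr_ge0// weight_ge0.
transitivity (\int[P]_w ((weight u N w * \1_(hits K) w)%:E
    + u%:E * (weight u N w * \1_(hits (N |` K)%fset) w)%:E))%E.
  apply: eq_integral => w _; rewrite -EFinM -EFinD; congr EFin.
  rewrite /weight big_ord_recr/=.
  have -> : \1_(hits (N |` K)%fset) w = \1_(hit N) w * \1_(hits K) w :> R.
    rewrite -[RHS]/((\1_(hit N) \* \1_(hits K)) w) -indicI.
    congr (\1_ _ w); apply/seteqP; split=> v.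
      move=> h; split; first by apply: h; rewrite /= !inE eqxx.
      by move=> i iK; apply: h; rewrite /= !inE (iK : i \in K) orbT.
    by move=> [h1 h2] i /=; rewrite !inE => /orP[/eqP -> //|iK]; exact: h2.
  set a := \prod_(_ < N) _; set b := \1_(hit N) w; set e := \1_(hits K) w.
  by rewrite mulrDr mulr1 mulrDl !mulrA [a * u]mulrC.
rewrite ge0_integralD//; last 2 first.
- by move=> w _; rewrite mule_ge0.
- by apply: emeasurable_funM => //; exact: measurable_cst.
rewrite ge0_integralZl// IH; last by move=> i /NK /ltnW.
rewrite IH; last first.
  by move=> i; rewrite !inE => /orP[/eqP -> //|/NK /ltnW].
rewrite -EFinM -EFinD cardfsU1 NnK/= add1n; congr EFin.
by rewrite !exprS mulrDl mul1r mulrDl -!mulrA; congr (_ + _ * _); rewrite mulrCA.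
Qed.

(** Compared factor by factor: [1 / (1 + u) = 1 - u / (1 + u)] is at most [expR (- (u / (1 + u)))],
    and taking inverses gives [expR (u / (1 + u)) <= 1 + u]. *)
Local Lemma le_weight (u : R) N w : 0 <= u ->
  expR (u / (1 + u) * \sum_(i < N) \1_(hit i) w) <= weight u N w.
Proof.
move=> u0; rewrite /weight; elim: N => [|N IH].
  by rewrite !big_ord0 mulr0 expR0.
rewrite !big_ord_recr/= mulrDr expRD ler_pM ?expR_ge0//.
rewrite indicE; case: (_ \in _); rewrite ?mulr1 ?mulr0 ?expR0 ?addr0//.
have u1 : 0 < 1 + u by rewrite ltr_pwDl.
rewrite -[leRHS]invrK -[leLHS]invrK lef_pV2 ?posrE ?invr_gt0 ?expR_gt0//.
rewrite -expRN; apply: le_trans (expR_ge1Dx _).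
rewrite -[X in X - _](divff (lt0r_neq0 u1)) -mulrBl.
by rewrite [1 + u - u]addrK mul1r.
Qed.

(** Markov's inequality for [weight]: on the event it is at least [a], by [le_weight], and its mean
    [(1 + u * p) ^+ N] is at most [expR (u * p) ^+ N]. *)
Local Lemma chernoff_hits (u q : R) N : 0 <= u ->
  (P [set w | (q * N%:R <= \sum_(i < N) \1_(hit i) w)%R] <=
   (expR (u * p - u / (1 + u) * q) ^+ N)%:E)%E.
Proof.
move=> u0; set S := [set w | _].
have mS : measurable S.
  rewrite -[S]setTI; apply: measurable_fun_le => //.
  by apply: measurable_sum => i; exact/measurable_indicP/measurable_hit.
set a := expR (u / (1 + u) * (q * N%:R)).
have aS : (a%:E * P S <= ((1 + u * p) ^+ N)%:E)%E.
  have := @integral_weight_hits u N fset0 u0 (fun i => ltac:(by rewrite inE)).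
  rewrite cardfs0 expr0 mulr1 => <-.
  rewrite -[S in P S]setIT -integral_indic// -ge0_integralZl//; last 2 first.
  - by apply/measurable_EFinP; exact/measurable_indicP.
  - by rewrite lee_fin expR_ge0.
  apply: ge0_le_integral => //.
  - by move=> w _; rewrite -EFinM lee_fin mulr_ge0// expR_ge0.
  - by apply: emeasurable_funM => //; apply/measurable_EFinP/measurable_indicP.
  - apply/measurable_EFinP; apply: measurable_funM; first exact: measurable_weight.
    exact/measurable_indicP/measurable_hits.
  move=> w _; rewrite -EFinM lee_fin.
  have -> : hits fset0 = setT by rewrite -subTset => v _ i /=; rewrite inE.
  rewrite indicT mulr1 indicE; have [|_] := boolP (w \in S); last first.
    by rewrite mulr0 weight_ge0.
  rewrite inE mulr1 => Sw; apply: le_trans (le_weight N w u0).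
  by rewrite ler_expR ler_wpM2l// divr_ge0// addr_ge0.
have -> : expR (u * p - u / (1 + u) * q) ^+ N = a^-1 * expR (u * p) ^+ N.
  rewrite expRD exprMn mulrC; congr (_ * _).
  by rewrite -expRM_natr -expRN mulNr mulrA.
rewrite EFinM lee_pdivlMl ?expR_gt0//.
apply: (le_trans aS); rewrite lee_fin lerXn2r ?nnegrE ?expR_ge0 ?expR_ge1Dx//.
by rewrite addr_ge0// mulr_ge0// fine_ge0.
Qed.

(** For a suitable [u] the Chernoff bounds form a convergent geometric series, so by Borel-Cantelli
    almost surely only finitely many of the events [F N] occur. *)
Lemma frequency_eventually_lt q : fine (P (Y @^-1` A)) < q ->
  {ae P, forall w,
     \forall N \near \oo, \sum_(i < N) \1_A (X i w) < q * N%:R}.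
Proof.
rewrite -/p => pq.
have p0 : 0 <= p by rewrite fine_ge0.
have [u u0 uq] : exists2 u : R, 0 < u & u * p - u / (1 + u) * q < 0.
  have q0 : 0 < q := le_lt_trans p0 pq.
  have q1 : 0 < 1 + q by rewrite addr_gt0.
  (* The exponent is negative exactly when [u * p < q - p]; dividing [q - p] by [1 + q], which
     exceeds [p], ensures this. *)
  exists ((q - p) / (1 + q)); first by rewrite divr_gt0// subr_gt0.
  set u := _ / _.
  have u0 : 0 < u by rewrite divr_gt0// subr_gt0.
  have u1 : 0 < 1 + u by rewrite addr_gt0.
  rewrite subr_lt0 -mulrA ltr_pM2l// mulrC ltr_pdivlMr// mulrDr mulr1.
  rewrite -ltrBrDl /u mulrCA -[ltRHS]mulr1 ltr_pM2l ?subr_gt0//.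
  by rewrite ltr_pdivrMr// mul1r (lt_le_trans pq)// lerDr.
set r := expR (u * p - u / (1 + u) * q).
have r1 : `|r| < 1 by rewrite ger0_norm ?expR_ge0// expR_lt1.
pose F N := [set w | q * N%:R <= \sum_(i < N) \1_(hit i) w].
have mF N : measurable (F N).
  rewrite -[F N]setTI; apply: measurable_fun_le => //.
  by apply: measurable_sum => i; exact/measurable_indicP/measurable_hit.
have F0 : P (lim_sup_set F) = 0%E.
  apply: lim_sup_set_cvg0 => //.
  apply: (@le_lt_trans _ _ (\sum_(N <oo) (r ^+ N)%:E)%E).
    by apply: lee_nneseries => // N _; apply: chernoff_hits; exact: ltW.
  have := is_cvg_geometric_series (a := 1) r1.
  move=> /cvg_ex[l rl]; rewrite (_ : limn _ = l%:E) ?ltry//.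
  apply/cvg_lim => //.
  rewrite (_ : (fun _ => _) = EFin \o series (geometric 1 r)).
    by apply: cvg_EFin => //; exact: nearW.
  apply/funext => N /=; rewrite /series/= -sumEFin.
  by apply: eq_bigr => i _; rewrite mul1r.
have mlim : measurable (lim_sup_set F).
  by apply: bigcap_measurable => // k _; exact: bigcup_measurable.
exists (lim_sup_set F); split=> // w /=; apply: contra_notP.
move=> nF; have [k nFk] : exists k, forall N, (k <= N)%N -> ~ F N w.
  apply/not_existsP => h; apply: nF => k _.
  have /existsNP[N /not_implyP[kN /contrapT FN]] := h k.
  by exists N.
by exists k => // N /= /nFk /negP; rewrite -ltNge.
Qed.

End Frequencies.

(** * The smoothing function and the smoothed sample quantile *)

Section Smoothing.
Context {R : realType} (gamma : R -> R -> R) (eps : R).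
Hypotheses (eps0 : 0 < eps) (hgamma : smoothing gamma eps).

Let G := Gamma gamma eps.

Lemma Gamma_itv y : 0 <= G y <= 1.
Proof.
have [g01 _ _ _] := hgamma; rewrite /G /Gamma.
case: (leP y (- eps)) => [_|ey]; first by rewrite ler01 lexx.
by case: (ltP y eps) => [ye|_]; rewrite ?lexx ?ler01//; apply: g01; rewrite !ltW.
Qed.

Lemma Gamma_eq1 y : y <= - eps -> G y = 1.
Proof. by rewrite /G /Gamma => ->. Qed.

Lemma Gamma_eq0 y : eps <= y -> G y = 0.
Proof.
move=> ey; rewrite /G /Gamma leNgt (lt_le_trans _ ey) ?gtrN//=.
by rewrite ltNge ey.
Qed.

(** When [z] is at or beyond [eps], strictness comes from [0 <= gamma eps eps < gamma eps y]. *)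
Lemma Gamma_lt y z : - eps < y < eps -> y < z -> G z < G y.
Proof.
move=> /andP[ey ye] yz; have [g01 gdec _ _] := hgamma.
have [ez|ze] := leP eps z.
  rewrite Gamma_eq0// /G /Gamma leNgt ey ye/=.
  have e2 : - eps <= eps <= eps by rewrite lexx andbT ge0_cp ?ltW.
  have /andP[g0 _] := g01 _ e2.
  by apply: (le_lt_trans g0); apply: gdec => //; exact: ltW.
rewrite /G /Gamma !leNgt ey ye (lt_trans ey yz) ze/=.
by apply: gdec => //; exact: ltW.
Qed.

Lemma Gamma_le y z : y <= z -> G z <= G y.
Proof.
rewrite le_eqVlt => /predU1P[->//|yz].
have [ey|ye] := leP y (- eps).
  by rewrite (Gamma_eq1 ey); case/andP: (Gamma_itv z).
have [ey|{}ey] := ltP y eps; first by rewrite ltW// Gamma_lt// ye ey.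
by rewrite !Gamma_eq0// (le_trans ey (ltW yz)).
Qed.

Lemma Gamma_continuous : continuous G.
Proof.
move=> y; have [_ _ _ dG] := hgamma.
by apply: differentiable_continuous; exact/derivable1_diffP.
Qed.

Section Quantile.
Variables (N : nat) (z : 'rV[R]_N).

Let H Q := \sum_(i < N) G (z ord0 i - Q).

Local Lemma smoothed_count_le Q1 Q2 : Q1 <= Q2 -> H Q1 <= H Q2.
Proof. by move=> Q12; apply: ler_sum => i _; rewrite Gamma_le// lerB. Qed.

(** Intermediate value theorem: every term is 0 at [- b] and 1 at [b], since [b] exceeds each
    [|z_i|] by at least [eps]. *)
Local Lemma smoothed_count_surj v : 0 <= v <= N%:R -> exists Q, H Q = v.
Proof.
move=> /andP[v0 vN]; pose b := \sum_(i < N) `|z ord0 i| + eps.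
have zb i : `|z ord0 i| <= b - eps.
  rewrite /b addrK (bigD1 i)//= lerDl.
  by apply: sumr_ge0 => j _; exact: normr_ge0.
have b0 : 0 <= b by rewrite addr_ge0 ?(ltW eps0)// sumr_ge0.
have HNb : H (- b) = 0.
  rewrite /H big1// => i _; apply: Gamma_eq0.
  by have := zb i; rewrite ler_norml => /andP[]; lra.
have Hb : H b = N%:R.
  rewrite /H (eq_bigr (fun=> 1)) ?sumr_const ?card_ord// => i _.
  by apply: Gamma_eq1; have := zb i; rewrite ler_norml => /andP[]; lra.
have cH : {within `[- b, b], continuous H}.
  apply: continuous_subspaceT; apply: continuous_big => [|i _].
    exact: add_continuous.
  move=> Q; apply: (@continuous_comp _ _ _ (fun Q => z ord0 i - Q) G).
    by apply: cvgB; [exact: cvg_cst|exact: cvg_id].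
  exact: Gamma_continuous.
have [||Q _ HQ] := @IVT _ H (- b) b v _ cH; last by exists Q.
- by rewrite ge0_cp.
- by rewrite HNb Hb ge_min le_max v0 vN orbT.
Qed.

(* The sample quantile is unique because (1 - alpha) N is not an integer: then
   some z_i lies where Gamma is strictly decreasing. *)
Lemma Qeps_le0 (alpha : R) :
  0 < alpha < 1 -> (1 - alpha) * N%:R \notin Num.int ->
  (Qeps gamma alpha eps z <= 0) =
  ((1 - alpha) * N%:R <= \sum_(i < N) G (z ord0 i)).
Proof.
move=> /andP[a0 a1] nint; set v := _ * _.
have v0N : 0 <= v <= N%:R.
  by rewrite mulr_ge0 ?subr_ge0 ?(ltW a1)//= ler_piMl// gerBl ltW.
have H0 : H 0 = \sum_(i < N) G (z ord0 i).
  by apply: eq_bigr => i _; rewrite subr0.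
have [Q0 HQ0] := smoothed_count_surj v0N.
have HQ : H (Qeps gamma alpha eps z) = v.
  by rewrite /Qeps; case: xgetP => [Q _ //|/(_ Q0)].
set Q := Qeps _ _ _ _ in HQ *; rewrite -H0.
apply/idP/idP => [Q0le|vH]; first by rewrite -HQ smoothed_count_le.
rewrite leNgt; apply/negP => Qgt0.
have [i zi] : exists i, - eps < z ord0 i - Q < eps.
  apply: contrapT => /forallNP nz; move/negP: nint; apply.
  rewrite -/v -HQ; apply: rpred_sum => i _.
  have [?|ez] := leP (z ord0 i - Q) (- eps); first by rewrite Gamma_eq1// rpred1.
  have [ze|?] := ltP (z ord0 i - Q) eps; last by rewrite Gamma_eq0// rpred0.
  by case: (nz i); rewrite ez ze.
have : H 0 < H Q.
  rewrite /H (bigD1 i)//= [ltRHS](bigD1 i)//=; apply: ltr_leD.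
    by apply: Gamma_lt => //; rewrite ltrD2l ltrN2.
  by apply: ler_sum => j _; rewrite Gamma_le// lerD2l lerN2 ltW.
by rewrite HQ ltNge vH.
Qed.

End Quantile.
End Smoothing.

(** * Euclidean norm, optimal values and limits in the extended reals *)

Lemma l2norm_ge0 (R : realType) n (v : 'rV[R]_n) : 0 <= l2norm v.
Proof. exact: sqrtr_ge0. Qed.

Lemma le_coord_l2norm (R : realType) n (v : 'rV[R]_n) i : `|v ord0 i| <= l2norm v.
Proof.
rewrite -sqrtr_sqr ler_wsqrtr// (bigD1 i)//= lerDl.
by apply: sumr_ge0 => j _; exact: sqr_ge0.
Qed.

Lemma l2norm_continuous (R : realType) n : continuous (@l2norm R n).
Proof.
move=> v.
apply: (@continuous_comp _ _ _
  (fun v : 'rV[R]_n => \sum_(i < n) v ord0 i ^+ 2) Num.sqrt);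
  last exact: sqrt_continuous.
move: v; apply: continuous_big => [|i _]; first exact: add_continuous.
move=> v; apply: (@continuous_comp _ _ _
  (fun v : 'rV[R]_n => v ord0 i) (fun x : R => x ^+ 2)).
  exact: coord_continuous.
exact: exprn_continuous.
Qed.

Lemma near_l2norm_lt (R : realType) n (x : 'rV[R]_n) (e : R) : 0 < e ->
  \forall y \near x, l2norm (y - x) < e.
Proof.
move=> e0.
have cx : {for x, continuous (fun y : 'rV[R]_n => l2norm (y - x))}.
  apply: (@continuous_comp _ _ _ (fun y : 'rV[R]_n => y - x) (@l2norm R n));
    last exact: l2norm_continuous.
  by apply: (@cvgB _ _ _ (nbhs x) _ id (cst x)); [exact: cvg_id|exact: cvg_cst].
apply: (cx [set r | r < e]); apply: lt_nbhsl.
by rewrite subrr /l2norm big1 ?sqrtr0// => i _; rewrite mxE expr0n.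
Qed.

Lemma optimal_valueE (R : realType) n (f : 'rV[R]_n -> R) A x :
  optimal_solutions f A x -> optimal_value f A = (f x)%:E.
Proof.
move=> [Ax xmin]; apply/eqP; rewrite eq_le; apply/andP; split.
  by apply: ereal_inf_lbound; exists x.
by apply: le_ereal_inf_tmp => _ [y Ay <-]; rewrite lee_fin xmin.
Qed.

(** The bounds also force [g] to be finite eventually, which reduces the claim to a real limit. *)
Lemma cvge_squeeze_eps (R : realType) I (F : set_system I) {FF : Filter F}
    (g : I -> \bar R) (l : R) :
  (forall e : R, 0 < e -> \forall i \near F, ((l - e)%:E <= g i <= (l + e)%:E)%E) ->
  g i @[i --> F] --> l%:E.
Proof.
move=> gl; apply/fine_cvgP; split.
  apply: filterS (gl 1 ltr01) => i.
  by case: (g i) => [r| |]; rewrite ?leye_eq ?leeNy_eq ?andbF.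
apply/cvgrPdist_le => e e0; apply: filterS (gl e e0) => i /=.
case: (g i) => [r| |]; rewrite ?lee_fin ?ler_distlC//.
by rewrite leye_eq andbF.
Qed.

(** * Stability of optimal values and solutions under perturbed feasible sets *)

Section Consistency.
Context {R : realType} {n : nat} {I : Type} (F : set_system I) {FF : Filter F}.
Variables (X : set 'rV[R]_n) (f : 'rV[R]_n -> R).
Variables (A : set 'rV[R]_n) (B : I -> set 'rV[R]_n).
Hypotheses (cX : compact X) (cf : continuous f) (AX : A `<=` X).
Hypothesis BX : \forall i \near F, B i `<=` X.
Hypothesis cB : \forall i \near F, compact (B i).
Hypothesis BA : forall x, X x -> ~ A x -> \forall y \near x & i \near F, ~ B i y.
Variable xbar : 'rV[R]_n.
Hypothesis xbar_opt : optimal_solutions f A xbar.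
Hypothesis approx_xbar : forall e : R, 0 < e ->
  exists2 x, f x < f xbar + e & \forall i \near F, B i x.

Local Lemma near_fst (U : set 'rV[R]_n) (x : 'rV[R]_n) : nbhs x U ->
  \forall y \near x & i \near F, U y.
Proof.
by move=> xU; exists (U, setT) => [|[y i] []//]; split=> //; exact: filterT.
Qed.

Local Lemma near_snd (Q : I -> Prop) (x : 'rV[R]_n) :
  (\forall i \near F, Q i) -> \forall y \near x & i \near F, Q i.
Proof.
by move=> FQ; exists (setT, Q) => [|[y i] []//]; split=> //; exact: filterT.
Qed.

Local Lemma near_lb_value e : 0 < e ->
  \forall i \near F, forall x, B i x -> f xbar - e < f x.
Proof.
move=> e0.
(* Near-covering form of compactness: a claim that holds around each point of [X], eventually in
   [i], becomes uniform over [X]. *)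
have : \forall i \near F, X `<=` (fun x => B i x -> f xbar - e < f x).
  apply: (iffLR (compact_near_coveringP _) cX) => x Xx.
  have [Ax|nAx] := pselect (A x); last first.
    by apply: filterS (BA Xx nAx) => -[y i] /=.
  apply: filterS (near_fst (U := [set y | f xbar - e < f y]) _) => [[y i] //|].
  apply: (@cf x [set r | f xbar - e < r]); apply: lt_nbhsr.
  by rewrite ltrBlDr (le_lt_trans (xbar_opt.2 _ Ax))// ltrDl.
by apply: filterS2 BX => i BXi h x Bx; apply: h => //; exact: BXi.
Qed.

(** The continuous [f] attains its minimum over the compact set [B i], which eventually contains a
    point supplied by [approx_xbar]. *)
Lemma near_optimal_solutions_neq0 :
  \forall i \near F, optimal_solutions f (B i) !=set0.
Proof.
have [x _ Bx] := approx_xbar ltr01.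
apply: filterS2 cB Bx => i cBi Bix.
have [||y yB ymin] := @compact_EVT_min _ R f (B i) _ cBi _.
- by exists x.
- exact: continuous_subspaceT.
exists y; split; first by rewrite -inE.
by move=> t Bt; apply: ymin; rewrite inE.
Qed.

Lemma cvg_optimal_value :
  optimal_value f (B i) @[i --> F] --> optimal_value f A.
Proof.
rewrite (optimal_valueE xbar_opt); apply: cvge_squeeze_eps => e e0.
have [x fx Bx] := approx_xbar e0.
apply: filterS2 (near_lb_value e0) Bx => i fB Bix; apply/andP; split.
  by apply: le_ereal_inf_tmp => _ [y By <-]; rewrite lee_fin ltW// fB.
apply: (@le_trans _ _ (f x)%:E); last by rewrite lee_fin ltW.
by apply: ereal_inf_lbound; exists x.
Qed.

(** Around a point outside [A], [B i] is eventually empty; around a suboptimal point of [A], some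
    [z] in [B i] is eventually better; around an optimal point, that point itself is close. *)
Local Lemma near_close_solutions e : 0 < e ->
  \forall i \near F, forall x, optimal_solutions f (B i) x ->
    exists2 b, optimal_solutions f A b & l2norm (x - b) < e.
Proof.
move=> e0.
have : \forall i \near F, X `<=` (fun x => optimal_solutions f (B i) x ->
    exists2 b, optimal_solutions f A b & l2norm (x - b) < e).
  apply: (iffLR (compact_near_coveringP _) cX) => x Xx.
  have [Ax|nAx] := pselect (A x); last first.
    by apply: filterS (BA Xx nAx) => -[y i] /= nB [].
  have [xbarx|xxbar] := ltP (f xbar) (f x).
    (* With half the gap as tolerance, [f z] stays below [f x], hence below the values at all points
       near [x]. *)
    have e20 : 0 < (f x - f xbar) / 2 by rewrite divr_gt0// subr_gt0.
    have [z fz Bz] := approx_xbar e20.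
    have fy : nbhs x [set y | f z < f y].
      apply: (@cf x [set r | f z < r]); apply: lt_nbhsr.
      by apply: (lt_trans fz); lra.
    apply: filterS2 (near_fst fy) (near_snd x Bz) => -[y i] /= zy Bz' [By ymin].
    by have := ymin _ Bz'; rewrite leNgt zy.
  have xopt : optimal_solutions f A x.
    by split=> // y Ay; exact: le_trans xxbar (xbar_opt.2 _ Ay).
  apply: filterS (near_fst (near_l2norm_lt x e0)) => -[y i] /= yx _.
  by exists x.
by apply: filterS2 BX => i BXi h x Bx; apply: h => //; apply: BXi; case: Bx.
Qed.

Lemma cvg_deviation :
  deviation (optimal_solutions f (B i)) (optimal_solutions f A) @[i --> F]
    --> 0%E.
Proof.
apply: cvge_squeeze_eps => e e0.
apply: filterS2 near_optimal_solutions_neq0 (near_close_solutions e0).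
move=> i [x xopt] close; rewrite sub0r add0r; apply/andP; split.
  apply: (@le_trans _ _ 0%E); first by rewrite lee_fin oppr_le0 ltW.
  (* Nonemptiness matters here: a supremum over no points would be [-oo]. *)
  apply: ereal_sup_ge; eexists; first by exists x; [exact: xopt|].
  by apply: le_ereal_inf_tmp => _ [b _ <-]; rewrite lee_fin l2norm_ge0.
apply: ge_ereal_sup => _ [y /close[b bopt yb] <-].
apply: (@le_trans _ _ (l2norm (y - b))%:E); last by rewrite lee_fin ltW.
by apply: ereal_inf_lbound; exists b.
Qed.

End Consistency.

(** An index encodes a rational centre [q] and a radius [1/(k+1)]; [Z i] is chosen in [X], and
    inside that ball whenever the ball meets [X]. *)
Lemma countable_dense_subset (R : realType) n (X : set 'rV[R]_n) : X !=set0 ->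
  exists2 Z : nat -> 'rV[R]_n, (forall i, X (Z i)) &
    forall x, X x -> forall e : R, 0 < e -> exists i, ball x e (Z i).
Proof.
move=> [x0 Xx0].
pose ratv (q : 'rV[rat]_n) : 'rV[R]_n := map_mx ratr q.
pose near_point (i : nat) (y : 'rV[R]_n) := forall (q : 'rV[rat]_n) (k : nat),
  choice.unpickle i = Some (q, k) ->
  (exists2 y', X y' & ball (ratv q) k.+1%:R^-1 y') ->
  ball (ratv q) k.+1%:R^-1 y.
have /choice[Z XZ] : forall i, exists y, X y /\ near_point i y.
  move=> i.
  case qk : (choice.unpickle i : option ('rV[rat]_n * nat)) => [[q k]|];
    last by exists x0; split=> // q k; rewrite qk.
  have [[y Xy qy]|nqy] := pselect (exists2 y', X y' &
      ball (ratv q) k.+1%:R^-1 y').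
    by exists y; split=> // q' k'; rewrite qk => -[<- <-].
  by exists x0; split=> // q' k'; rewrite qk => -[<- <-] /nqy.
exists Z => [i|x Xx e e0]; first by case: (XZ i).
have [k ke] : exists k : nat, k.+1%:R^-1 < e / 2.
  have e20 : 0 < e / 2 by rewrite divr_gt0.
  by have [k _ /(_ k (leqnn k))] := near_infty_natSinv_lt (PosNum e20); exists k.
have k0 : 0 < k.+1%:R^-1 :> R by rewrite invr_gt0.
have /choice[q xq] : forall j : 'I_n, exists q : rat,
    `|x ord0 j - ratr q| < k.+1%:R^-1.
  move=> j.
  have /rat_in_itvoo[q] : x ord0 j < x ord0 j + k.+1%:R^-1 by rewrite ltrDl.
  rewrite in_itv/= => /andP[xq qx].
  by exists q; rewrite ltr_distlC qx andbT (lt_trans _ xq)// ltrBlDr ltrDl.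
(* This ball meets [X] at [x], so it contains the matching point of [Z]; two radii below [e / 2]
   then add up. *)
have qx : ball (ratv (\row_j q j)) k.+1%:R^-1 x.
  split=> // i j; rewrite !mxE ord1 /ball/= distrC; exact: xq.
exists (choice.pickle (\row_j q j, k)).
have [_ /(_ (\row_j q j) k)] := XZ (choice.pickle (\row_j q j, k)).
rewrite choice.pickleK => /(_ erefl) qZ.
have {}qZ := qZ (ex_intro2 _ _ x Xx qx).
apply: (@ball_split _ _ (ratv (\row_j q j))).
  by apply: ball_sym; exact: le_ball (ltW ke) _ _.
exact: le_ball (ltW ke) _ _.
Qed.

(** * Events attached to balls, and their probabilities as the balls shrink *)

Section NeighbourhoodEvents.
Context d (T : measurableType d) (R : realType) (n : nat).
Variables (mu : probability T R) (X : set 'rV[R]_n) (C : 'rV[R]_n -> T -> R).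
Variable Z : nat -> 'rV[R]_n.
Hypothesis XZ : forall i, X (Z i).
Hypothesis dZ : forall x, X x -> forall e : R, 0 < e -> exists i, ball x e (Z i).
Hypothesis mC : forall x, X x -> measurable_fun [set: T] (C x).

(* A countable union, hence measurable although the event that C(y, .) < r for
   some y in X near x need not be; by nbhd_eventP the two agree wherever
   C(., u) is continuous. *)
Definition nbhd_event (x : 'rV[R]_n) (r : R) : set T :=
  \bigcup_(i in [set i | ball x r (Z i)]) [set u | C (Z i) u < r].

Lemma measurable_nbhd_event x r : measurable (nbhd_event x r).
Proof.
apply: bigcup_measurable => i _; rewrite -[X in measurable X]setTI.
rewrite (_ : [set u | _] = C (Z i) @^-1` `]-oo, r[); last first.
  by apply/seteqP; split=> u; rewrite /= in_itv.
exact: (mC (XZ i) measurableT (measurable_itv _)).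
Qed.

Lemma sub_nbhd_event x r y s : (forall z, ball x r z -> ball y s z) -> r <= s ->
  nbhd_event x r `<=` nbhd_event y s.
Proof.
by move=> xy rs u [i /xy ? ur]; exists i => //; exact: lt_le_trans ur rs.
Qed.

(** Both conditions on [y] are open, so they pass to a point of [Z] close to [y]. *)
Lemma nbhd_eventP u x r y : continuous (C ^~ u) -> X y -> ball x r y ->
  C y u < r -> nbhd_event x r u.
Proof.
move=> Cu Xy xy Cyr.
have /nbhs_ballP[e /= e0 ye] : \forall z \near y, ball x r z /\ C z u < r.
  apply: filterI.
    apply: open_nbhs_nbhs; split=> //; exact: ball_open.
  by apply: (Cu y [set t | t < r]); exact: lt_nbhsl.
by have [i /ye[]] := dZ Xy e0; exists i.
Qed.

(** Continuity from above along balls shrinking to [x]. The ball is then recentred at a point of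
    [Z], so that only countably many events arise. *)
Lemma nbhd_event_lt x q : X x -> {ae mu, forall u, continuous (C ^~ u)} ->
  (mu [set u | C x u <= 0]%R < q%:E)%E ->
  exists i k, ball (Z i) k.+1%:R^-1 x /\
    (mu (nbhd_event (Z i) k.+1%:R^-1) < q%:E)%E.
Proof.
move=> Xx [N [mN N0 nC]] muq.
pose E k := nbhd_event x k.+1%:R^-1.
have mE k : measurable (E k) by exact: measurable_nbhd_event.
have leV (k l : nat) : (k <= l)%N -> (l.+1%:R^-1 : R) <= k.+1%:R^-1.
  by move=> kl; rewrite lef_pV2 ?posrE// ler_nat.
have niE : nonincreasing_seq E.
  move=> k l kl; apply/subsetPset; apply: sub_nbhd_event; last exact: leV.
  exact: le_ball (leV _ _ kl).
have mcap : measurable (\bigcap_k E k) by exact: bigcap_measurable.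
have m0 : measurable [set u | C x u <= 0].
  rewrite -[X in measurable X]setTI.
  by apply: measurable_fun_le => //; exact: mC.
(* Off the null set, [C x u > 0] would give [C z u > C x u / 2] for all [z] near [x], whereas [E k]
   yields points of [Z] near [x] with values below [1/(k+1)]. *)
have capE : (mu (\bigcap_k E k) <= mu [set u | C x u <= 0]%R)%E.
  rewrite -[leRHS]adde0 -N0.
  apply: le_trans (measureU2 _ m0 mN).
  apply: le_measure; rewrite ?inE//; first exact: measurableU.
  move=> u Eu; have [Cu|/nC] := pselect (continuous (C ^~ u)); [left|by right].
  rewrite /= leNgt; apply/negP => Cxu.
  have /nbhs_ballP[e /= e0 xe] : \forall z \near x, C x u / 2 < C z u.
    apply: (Cu x [set t | C x u / 2 < t]); apply: lt_nbhsr.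
    by rewrite ltr_pdivrMr// ltr_pMr// ltr1n.
  have e'0 : 0 < Num.min e (C x u / 2) by rewrite lt_min e0 divr_gt0.
  have [k _ /(_ k (leqnn k))] := near_infty_natSinv_lt (PosNum e'0).
  rewrite /= lt_min => /andP[ke kC].
  have [i xi Ci] := Eu k I.
  have /xe/= : ball x e (Z i) by exact: le_ball (ltW ke) _ xi.
  by move=> /(lt_trans kC); rewrite ltNge ltW.
have [k Ekq] : exists k, (mu (E k) < q%:E)%E.
  have Ecvg : mu \o E @ \oo --> mu (\bigcap_k E k).
    apply: nonincreasing_cvg_mu => //.
    by rewrite (le_lt_trans (probability_le1 _ _))// ltry.
  have capq := le_lt_trans capE muq.
  have [k _ /(_ k (leqnn k))] := Ecvg _ (open_ereal_lt' capq).
  by exists k.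
(* Then [1/(l+1)] is half of [1/(k+1)]: a ball of the smaller radius centred that close to [x] lies
   in the larger ball around [x]. *)
pose l := k.*2.+1.
have l2 : (l.+1%:R^-1 : R) *+ 2 = k.+1%:R^-1.
  rewrite /l -doubleS -mul2n natrM invfM -[LHS]mulr_natl mulrA divff ?mul1r//.
have l0 : 0 < l.+1%:R^-1 :> R by rewrite invr_gt0.
have [i xi] := dZ Xx l0.
exists i, l; split; first exact: ball_sym.
apply: le_lt_trans Ekq; apply: le_measure; rewrite ?inE//.
  exact: measurable_nbhd_event.
apply: sub_nbhd_event; last by rewrite -l2 mulr2n lerDl ltW.
by move=> z iz; rewrite -l2 mulr2n; apply: ball_triangle xi iz.
Qed.

End NeighbourhoodEvents.

(** * Eventual statements along the joint limit *)

Section JointLimit.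
Context {R : realType} (alpha : R).

Lemma near_joint_sample (Q : nat -> Prop) : (\forall N \near \oo, Q N) ->
  \forall p \near joint_limit alpha, Q p.1.
Proof.
move=> FQ; apply: cvg_within.
by exists (Q, setT) => [|[N e] []//]; split=> //; exact: filterT.
Qed.

Lemma near_joint_eps (Q : R -> Prop) : (\forall e \near 0^'+, Q e) ->
  \forall p \near joint_limit alpha, Q p.2.
Proof.
move=> FQ; apply: cvg_within.
by exists (setT, Q) => [|[N e] []//]; split=> //; exact: filterT.
Qed.

Lemma near_joint_notin_int :
  \forall p \near joint_limit alpha, (1 - alpha) * p.1%:R \notin Num.int.
Proof. exact: withinT. Qed.

End JointLimit.

(** Each [X i] has the law of [Y], so it pulls null sets back to null sets, and a countable union of
    these is null. *)
Lemma ae_iid_copies d (Omega : measurableType d) d' (T : measurableType d')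
    (R : realType) (P : probability Omega R) (Y : {RV P >-> T})
    (X : nat -> {RV P >-> T}) (Q : T -> Prop) : iid_copies Y X ->
  {ae distribution P Y, forall u, Q u} -> {ae P, forall w i, Q (X i w)}.
Proof.
move=> [_ distX] [N [mN N0 QN]]; apply: ae_foralln => i.
exists (X i @^-1` N); split.
- by rewrite -[X in measurable X]setTI; exact: measurable_funP.
- by have := distX i N mN; rewrite N0.
- by move=> w /= nQ; exact: QN.
Qed.

(** * Smoothed counts on a fixed sample *)

Section Sample.
Context {R : realType} {n s m : nat}.
Variables (c : 'rV[R]_n -> 'rV[R]_s -> 'rV[R]_m.+1) (gamma : R -> R -> R).
Hypothesis hgamma : forall eps : R, 0 < eps -> smoothing gamma eps.
Variables (alpha : R) (X : set 'rV[R]_n) (u : nat -> 'rV[R]_s).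
Hypothesis halpha : 0 < alpha < 1.

Lemma approx_feasibleP (N : nat) (eps : R) (x : 'rV[R]_n) :
  0 < eps -> (1 - alpha) * N%:R \notin Num.int ->
  approx_feasible c gamma alpha X u N eps x <->
  X x /\ (1 - alpha) * N%:R <= \sum_(i < N) Gamma gamma eps (Cmax c x (u i)).
Proof.
move=> eps0 nint; rewrite /approx_feasible/= (Qeps_le0 eps0 (hgamma eps0))//.
suff -> : \sum_(i < N) Gamma gamma eps (Csample c N u x ord0 i) =
    \sum_(i < N) Gamma gamma eps (Cmax c x (u i)) by [].
by apply: eq_bigr => i _; rewrite mxE.
Qed.

(** [Gamma] vanishes from [eps] on and never exceeds 1. With [A] a neighbourhood event, this bounds
    the smoothed counts at all points of [X] in a ball at once. *)
Lemma smoothed_sum_le (N : nat) (eps : R) (x : 'rV[R]_n) (A : set 'rV[R]_s) :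
  0 < eps -> (forall i, Cmax c x (u i) < eps -> A (u i)) ->
  \sum_(i < N) Gamma gamma eps (Cmax c x (u i)) <= \sum_(i < N) \1_A (u i) :> R.
Proof.
move=> eps0 CA; apply: ler_sum => i _.
have /andP[_ G1] := Gamma_itv (hgamma eps0) (Cmax c x (u i)).
have [/CA Au|eC] := ltP (Cmax c x (u i)) eps; first by rewrite indicE mem_set.
by rewrite Gamma_eq0.
Qed.

(** [Gamma] equals 1 up to [- eps], so each sample point outside [A] contributes a full unit. *)
Lemma smoothed_sum_ge (N : nat) (eps : R) (x : 'rV[R]_n) (A : set 'rV[R]_s) :
  0 < eps -> (forall i, - eps < Cmax c x (u i) -> A (u i)) ->
  N%:R - \sum_(i < N) \1_A (u i) <=
    \sum_(i < N) Gamma gamma eps (Cmax c x (u i)) :> R.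
Proof.
move=> eps0 CA; rewrite lerBlDr -big_split/=.
rewrite -[X in X%:R]card_ord -sumr_const; apply: ler_sum => i _.
have /andP[G0 _] := Gamma_itv (hgamma eps0) (Cmax c x (u i)).
have [Ce|/CA Au] := leP (Cmax c x (u i)) (- eps).
  by rewrite (Gamma_eq1 _ Ce) lerDl indicE.
by rewrite indicE mem_set// lerDr.
Qed.

Lemma compact_approx_feasible (N : nat) (eps : R) :
  0 < eps -> (1 - alpha) * N%:R \notin Num.int -> compact X ->
  (forall i, continuous (fun x => Cmax c x (u i))) ->
  compact (approx_feasible c gamma alpha X u N eps).
Proof.
move=> eps0 nint cX Cu.
pose S x := \sum_(i < N) Gamma gamma eps (Cmax c x (u i)).
have -> : approx_feasible c gamma alpha X u N eps =
    X `&` S @^-1` [set t | (1 - alpha) * N%:R <= t].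
  by apply/seteqP; split=> x; rewrite approx_feasibleP.
apply: compact_closedI => //; apply: preimage_closed; last exact: closed_ge.
move=> x _; move: x; apply: continuous_big => [|i _].
  exact: add_continuous.
move=> x.
apply: (@continuous_comp _ _ _ (fun x => Cmax c x (u i)) (Gamma gamma eps)).
  exact: Cu.
exact: (Gamma_continuous (hgamma eps0)).
Qed.

End Sample.

(** * Almost sure convergence of the optimal values and the solution sets *)

Theorem theorem3p5 (R : realType) (n s m : nat)
  (d : measure_display) (Omega : measurableType d) (P : probability Omega R)
  (X : set 'rV[R]_n) (f : 'rV[R]_n -> R)
  (c : 'rV[R]_n -> 'rV[R]_s -> 'rV[R]_m.+1)
  (xi : {RV P >-> borel_rV R s}) (Xi : set 'rV[R]_s)
  (xis : nat -> {RV P >-> borel_rV R s})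
  (alpha : R) (gamma : R -> R -> R)
  (hXi : is_support (distribution P xi) Xi)
  (hiid : iid_copies xi xis)
  (halpha : 0 < alpha < 1)
  (hgamma : forall eps : R, 0 < eps -> smoothing gamma eps)
  (hX : compact X)
  (hf : continuous f)
  (h1 : forall x, X x -> continuous (fun t : R => Fcdf c P xi t x))
  (h2meas : forall x, X x ->
     measurable_fun [set: borel_rV R s] (Cmax c x : borel_rV R s -> R))
  (h2cont : {ae distribution P xi,
     forall u : borel_rV R s, Xi u ->
       continuous (fun x : 'rV[R]_n => Cmax c x u)})
  (h3 : exists2 xbar : 'rV[R]_n,
     optimal_solutions f (true_feasible c P xi alpha X) xbar &
     forall delta : R, 0 < delta ->
       exists x : 'rV[R]_n,
         [/\ X x, l2norm (x - xbar) <= delta & 1 - alpha < Fcdf c P xi 0 x]) :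
  {ae P, forall w : Omega,
     optimal_value f
       (approx_feasible c gamma alpha X (fun i => xis i w) p.1 p.2)
       @[p --> joint_limit alpha]
       --> optimal_value f (true_feasible c P xi alpha X)
     /\
     deviation
       (optimal_solutions f
          (approx_feasible c gamma alpha X (fun i => xis i w) p.1 p.2))
       (optimal_solutions f (true_feasible c P xi alpha X))
       @[p --> joint_limit alpha]
       --> 0%E}.
Proof.
have [xbar xbar_opt slater] := h3.
pose C (x : 'rV[R]_n) (u : borel_rV R s) : R := Cmax c x u.
have aeC : {ae distribution P xi, forall u, continuous (C ^~ u)}.
  have [cXi XiE _] := hXi.
  have mXi : measurable (~` Xi : set (borel_rV R s)).
    by apply: sub_sigma_algebra; rewrite /= openC.
  (* The support has probability 1, so continuity for almost all points of [Xi] is continuity almost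
     everywhere. *)
  have aeXi : {ae distribution P xi, forall u, Xi u}.
    exists (~` Xi); split=> //.
    have mXi' : measurable (Xi : set (borel_rV R s)).
      by rewrite -[Xi]setCK; exact: measurableC.
    by rewrite probability_setC// [X in (_ - X)%E]XiE subee.
  apply: (@filterS2 _ _ (ae_filter_ringOfSetsType _) _ _ _ _ aeXi h2cont).
  by move=> u Xiu; exact.
have [Z XZ dZ] : exists2 Z : nat -> 'rV[R]_n, (forall i, X (Z i)) &
    forall x, X x -> forall e : R, 0 < e -> exists i, ball x e (Z i).
  by apply: countable_dense_subset; exists xbar; case: xbar_opt => -[].
pose E i k : set (borel_rV R s) := nbhd_event C Z (Z i) k.+1%:R^-1.
have mE i k : measurable (E i k).
  exact: (measurable_nbhd_event XZ h2meas).
(* Strict feasibility at level 0 survives at a slightly negative level [xt.2], because the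
   distribution function is continuous; this leaves room for the smoothing width. *)
have /choice[xt xtP] : forall k : nat, exists xt : 'rV[R]_n * R,
    [/\ X xt.1, l2norm (xt.1 - xbar) <= k.+1%:R^-1, xt.2 < 0 &
      fine (P (xi @^-1` [set u | xt.2 < C xt.1 u])) < alpha].
  move=> k; have [|x [Xx xk Fx]] := slater k.+1%:R^-1; first by rewrite invr_gt0.
  have /nbhs_ballP[e /= e0 eF] :
      \forall t \near (0 : R), 1 - alpha < Fcdf c P xi t x.
    by apply: (h1 x Xx 0 [set r | 1 - alpha < r]); exact: lt_nbhsr.
  have e20 : 0 < e / 2 by rewrite divr_gt0.
  exists (x, - (e / 2)); split=> //=; first by rewrite oppr_lt0.
  have /eF/= : ball (0 : R) e (- (e / 2)).
    rewrite /ball/= sub0r opprK ger0_norm ?ltW//.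
    by rewrite ltr_pdivrMr// ltr_pMr// ltr1n.
  rewrite /Fcdf.
  have mD : measurable [set w | Cmax c x (xi w) <= - (e / 2)].
    rewrite -[X in measurable X]setTI; apply: measurable_fun_le => //.
    by apply: (measurableT_comp (h2meas _ Xx)).
  have -> : xi @^-1` [set u | - (e / 2) < C x u] =
      ~` [set w | Cmax c x (xi w) <= - (e / 2)].
    by apply/seteqP; split=> w /=; rewrite ltNge => /negP.
  rewrite probability_setC// fineB ?fin_num_measure//=; lra.
pose D k : set (borel_rV R s) := [set u | (xt k).2 < C (xt k).1 u].
have mD k : measurable (D k).
  have [Xx _ _ _] := xtP k.
  rewrite (_ : D k = C (xt k).1 @^-1` `](xt k).2, +oo[); last first.
    by apply/seteqP; split=> u; rewrite /= in_itv/= andbT.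
  rewrite -[X in measurable X]setTI.
  by apply: (h2meas _ Xx measurableT); exact: measurable_itv.
have aeW1 : {ae P, forall w i, continuous (C ^~ (xis i w))} :=
  ae_iid_copies hiid aeC.
have aeW2 : {ae P, forall w i k, fine (P (xi @^-1` E i k)) < 1 - alpha ->
    \forall N \near \oo, \sum_(j < N) \1_(E i k) (xis j w) < (1 - alpha) * N%:R}.
  apply: ae_foralln => i; apply: ae_foralln => k.
  have [Eia|nE] := pselect (fine (P (xi @^-1` E i k)) < 1 - alpha); last first.
    by apply: aeW => w /nE.
  by apply: filterS (frequency_eventually_lt hiid (mE i k) Eia).
have aeW3 : {ae P, forall w k,
    \forall N \near \oo, \sum_(j < N) \1_(D k) (xis j w) < alpha * N%:R}.
  apply: ae_foralln => k; have [_ _ _ Dk] := xtP k.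
  exact: (frequency_eventually_lt hiid (mD k) Dk).
have near_eps0 := near_joint_eps alpha (nbhs_right_gt (0 : R)).
have near_nint := near_joint_notin_int alpha.
apply: filterS3 aeW1 aeW2 aeW3 => w W1 W2 W3.
set AF := fun p => approx_feasible c gamma alpha X (fun i => xis i w) p.1 p.2.
have AFX : \forall p \near joint_limit alpha, AF p `<=` X.
  by apply: nearW => p x [].
have cAF : \forall p \near joint_limit alpha, compact (AF p).
  apply: filterS2 near_eps0 near_nint => p p0 pint.
  exact: compact_approx_feasible.
have infeasible x : X x -> ~ true_feasible c P xi alpha X x ->
    \forall y \near x & p \near joint_limit alpha, ~ AF p y.
  move=> Xx nFx.
  have [|i [k [ix]]] := @nbhd_event_lt _ _ R n (distribution P xi) X C Z XZ dZ
      h2meas x (1 - alpha) Xx aeC.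
    have FE : P [set w | Cmax c x (xi w) <= 0] = (Fcdf c P xi 0 x)%:E.
      rewrite /Fcdf fineK// fin_num_measure//.
      rewrite -[X in measurable X]setTI; apply: measurable_fun_le => //.
      by apply: (measurableT_comp (h2meas _ Xx)).
    rewrite -[ltLHS]/(P [set w | (Cmax c x (xi w) <= 0)%R]) FE lte_fin ltNge.
    by apply/negP => Fx; exact: nFx.
  move=> muE.
  have {}muE : fine (P (xi @^-1` E i k)) < 1 - alpha.
    rewrite -lte_fin fineK// fin_num_measure//.
    by rewrite -[X in measurable X]setTI; exact: measurable_funP.
  have {}ix : nbhs x (ball (Z i) k.+1%:R^-1).
    by apply: open_nbhs_nbhs; split=> //; exact: ball_open.
  have k0 : (0 : R) < k.+1%:R^-1 by rewrite invr_gt0.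
  have freq := near_joint_sample alpha (W2 i k muE).
  have small := near_joint_eps alpha (nbhs_right_lt k0).
  (* The good indices [p] must not depend on [y], since the goal concerns a product of filters. *)
  have [Q FQ Qp] : exists2 Q : set (nat * R), joint_limit alpha Q &
      forall p, Q p -> forall y, ball (Z i) k.+1%:R^-1 y -> ~ AF p y.
    exists [set p | forall y, ball (Z i) k.+1%:R^-1 y -> ~ AF p y] => //.
    apply: filterS2 (filterI near_eps0 near_nint) (filterI freq small).
    move=> p [p0 pint] [pfreq psmall] y iy.
    move=> /approx_feasibleP-/(_ hgamma halpha p0 pint)[Xy].
    (* Once [eps] is below the radius, every sample point with [C(y, .) < eps] falls in [E i k],
       which is hit fewer than [(1 - alpha) * N] times. *)
    rewrite leNgt => /negP; apply; apply: le_lt_trans pfreq.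
    apply: (smoothed_sum_le hgamma (u := fun j => xis j w) _ (A := E i k) p0).
    move=> j Cy.
    by apply: (nbhd_eventP dZ _ Xy iy); [exact: W1|exact: lt_trans Cy psmall].
  exists (ball (Z i) k.+1%:R^-1, Q) => [|[y p] [/= iy Qp']]; first by split.
  exact: Qp.
have near_xbar e : 0 < e -> exists2 x, f x < f xbar + e &
    \forall p \near joint_limit alpha, AF p x.
  move=> e0.
  have /nbhs_ballP[r /= r0 rf] : \forall x \near xbar, f x < f xbar + e.
    by apply: (hf xbar [set t | t < f xbar + e]); apply: lt_nbhsl; rewrite ltrDl.
  have [k _ /(_ k (leqnn k))/= kr] := near_infty_natSinv_lt (PosNum r0).
  have [Xx xk t0 _] := xtP k.
  exists (xt k).1.
    (* Balls are those of the sup norm, which the Euclidean norm dominates coordinate by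
       coordinate. *)
    apply: rf; split=> // i j; rewrite ord1 /ball/= distrC.
    have := le_coord_l2norm ((xt k).1 - xbar) j.
    rewrite !mxE => /le_lt_trans; apply.
    exact: le_lt_trans xk kr.
  have t'0 : 0 < - (xt k).2 by rewrite oppr_gt0.
  have freq := near_joint_sample alpha (W3 k).
  have small := near_joint_eps alpha (nbhs_right_lt t'0).
  apply: filterS2 (filterI near_eps0 near_nint) (filterI freq small).
  move=> p [p0 pint] [pfreq psmall]; apply/approx_feasibleP => //; split=> //.
  (* For [eps < - (xt k).2] every sample point outside [D k] counts fully, and fewer than
     [alpha * N] points lie in [D k]. *)
  apply: le_trans
    (smoothed_sum_ge hgamma (u := fun j => xis j w) _ (A := D k) p0 _).
    by rewrite mulrBl mul1r lerD2l lerN2 ltW.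
  by move=> j; apply: lt_trans; rewrite ltrNr.
split.
- exact: (cvg_optimal_value hX hf AFX infeasible xbar_opt near_xbar).
- exact: (cvg_deviation hX hf AFX cAF infeasible xbar_opt near_xbar).
Qed.
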